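(* Let $n$ be odd, $r\ge 1$, $v\in\mathbb{C}^\times$, $\lambda=(\lambda_1\ge\dots\ge\lambda_r\ge0)$ an integer partition, $\mathbf z=(z_1,\dots,z_r)\in(\mathbb{C}^{\times})^r$ and $\mathbf c=(c_1,\dots,c_r)\in\mathbb{Z}^r$ with every $c_k\in[0,n-1]$. Let $Z_\lambda(\mathbf z;\mathbf c)$ be the partition function of symplectic ice with prescribed left charges, as defined in the context. Put $N=\lambda_1+r+1$, let $e\equiv c_r-N\pmod n$ with $e\in[0,n-1]$, and let $C\equiv c_r-2e\pmod n$ with $C\in[0,n-1]$. Then $$(1-v)\,z_r^{\,n-2e}\,Z_\lambda(\mathbf z;\mathbf c)+g(2e)\,(z_r^{-n}-z_r^{n})\,Z_\lambda(\mathbf z;(c_1,\dots,c_{r-1},C))=(z_r^{-n}-vz_r^{n})\,Z_\lambda((z_1,\dots,z_{r-1},z_r^{-1});\mathbf c).$$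
   Context: Functions: $g:\mathbb{Z}\to\mathbb{C}$ is periodic modulo $n$ with $g(0)=-v$ and $g(a)g(n-a)=v$ whenever $n\nmid a$; $\delta(a)=1$ if $n\mid a$ and $0$ otherwise; $h(a)=(1-v)\delta(a)$. **Symplectic ice.** Let $\rho=(r,r-1,\dots,1)$. Take a rectangular lattice with $\lambda_1+r$ columns, numbered $1,2,\dots,\lambda_1+r$ from right to left, and $2r$ rows labelled $1,\overline1,2,\overline2,\dots,r,\overline r$ from top to bottom, with a vertex at each intersection. Each row has $\lambda_1+r+1$ horizontal edges; for each $i$, the rightmost edges of rows $i$ and $\overline i$ are joined by a bend containing one bend vertex. Every edge carries a spin $+$ or $-$. Boundary conditions: all spins on the left and bottom boundaries are $+$; the top boundary spin is $-$ in the columns numbered by the parts $\lambda_k+r+1-k$ of $\lambda+\rho$, and $+$ in the other columns. A state is an assignment of spins to the remaining edges. It is admissible if the two edges at every bend have different spins and every other vertex has one of the six configurations (left, right; top, bottom): $a_1=(+,+;+,+)$, $a_2=(-,-;-,-)$, $b_1=(+,+;-,-)$, $b_2=(-,-;+,+)$, $c_1=(-,+;+,-)$, $c_2=(+,-;-,+)$. Let $\mathfrak S_\lambda$ be the set of admissible states. **Charge.** In row $i$ (''$\Delta$ ice'') the charge at a horizontal edge is the number of $-$ spins on horizontal edges of the row at and to the left of it; the charge at a vertex is the charge at its left edge; the charge at the bend vertex joining rows $i,\overline i$ is the charge at the rightmost edge of row $i$. In row $\overline i$ (''$\Gamma$ ice'') the charge at a horizontal edge is the charge at the bend vertex plus the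 number of $+$ spins on horizontal edges of the row at and to the right of it; the charge at a vertex is the charge at its right edge. **Weights.** A vertex of charge $a$ in row $i$ has weight: $a_1:1$, $a_2:g(a)z_i$, $b_1:1$, $b_2:z_i$, $c_1:h(a)z_i$, $c_2:\delta(a)$. A vertex of charge $a$ in row $\overline i$ has weight: $a_1:1$, $a_2:z_i^{-1}$, $b_1:g(a)$, $b_2:z_i^{-1}$, $c_1:h(a)z_i^{-1}$, $c_2:\delta(a)$. A bend joining rows $i,\overline i$ with bend vertex of charge $a$ has weight $g(2a)z_i$ if its row-$i$ edge is $-$ and its row-$\overline i$ edge is $+$, and weight $z_i^{-1}$ if its row-$i$ edge is $+$ and its row-$\overline i$ edge is $-$. The weight $\mathrm{wt}(\mathfrak s)$ of an admissible state is the product of the weights of all its vertices, including bend vertices. $Z_\lambda(\mathbf z;\mathbf c)$ is the sum of $\mathrm{wt}(\mathfrak s)$ over all $\mathfrak s\in\mathfrak S_\lambda$ for which, for every $k$, the charge at the leftmost edge of row $\overline k$ is congruent to $c_k$ modulo $n$. *)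

(* Defs.v *)
From mathcomp Require Import all_boot all_order all_algebra.
From mathcomp Require Export reals complex.

Set Implicit Arguments.
Unset Strict Implicit.
Unset Printing Implicit Defensive.

Import GRing.Theory.
Local Open Scope ring_scope.

Notation spin := bool (only parsing).
Notation plus := true (only parsing).
Notation minus := false (only parsing).

Variant vertex_config := A1 | A2 | B1 | B2 | C1 | C2.

Definition config_of (left right top bottom : spin) : option vertex_config :=
  match left, right, top, bottom with
  | plus,  plus,  plus,  plus  => Some A1
  | minus, minus, minus, minus => Some A2
  | plus,  plus,  minus, minus => Some B1
  | minus, minus, plus,  plus  => Some B2
  | minus, plus,  plus,  minus => Some C1
  | plus,  minus, minus, plus  => Some C2
  | _, _, _, _ => None
  end.

(* Indices i, k : 'I_r and the entries of lambda are 0-based, so the index i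
   stands for the (i + 1)-st row pair, part, or variable. *)

Definition ncols r (lambda : r.-tuple nat) : nat := (head 0 lambda + r)%N.

(* The row (i, false) is the Delta row of the i-th pair, (i, true) the Gamma
   row (the barred one) just below it. *)
Definition lattice_row r := ('I_r * bool)%type.

(* A state assigns a spin to every edge; the boundary values are imposed by
   [admissible].  Positions are counted from the left: in a row the vertex
   j : 'I_L lies between the horizontal edges j and j + 1, and is in the column
   numbered L - j.  In a column, the vertical edge 0 is on the top boundary and
   the row with p rows above it lies between the vertical edges p and p + 1. *)
Definition state r L : finType :=
  ({ffun lattice_row r * 'I_L.+1 -> spin} * {ffun 'I_(r.*2).+1 * 'I_L -> spin})%type.

Section State.
Variables (r L : nat) (s : state r L).

Definition hspin (p : lattice_row r) (j : 'I_L.+1) : spin := s.1 (p, j).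
Definition vspin (q : 'I_(r.*2).+1) (j : 'I_L) : spin := s.2 (q, j).

Definition left_edge (j : 'I_L) : 'I_L.+1 := widen_ord (leqnSn L) j.
Definition right_edge (j : 'I_L) : 'I_L.+1 := lift ord0 j.
Definition top_edge (p : lattice_row r) : 'I_(r.*2).+1 := inord (p.1.*2 + p.2)%N.
Definition bottom_edge (p : lattice_row r) : 'I_(r.*2).+1 := inord (p.1.*2 + p.2).+1%N.

Definition vertex_at (p : lattice_row r) (j : 'I_L) : option vertex_config :=
  config_of (hspin p (left_edge j)) (hspin p (right_edge j))
            (vspin (top_edge p) j) (vspin (bottom_edge p) j).

Definition delta_charge (i : 'I_r) (j : 'I_L.+1) : nat :=
  #|[set k : 'I_L.+1 | (k <= j)%N && (hspin (i, false) k == minus)]|.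

Definition bend_charge (i : 'I_r) : nat := delta_charge i ord_max.

Definition gamma_charge (i : 'I_r) (j : 'I_L.+1) : nat :=
  (bend_charge i
   + #|[set k : 'I_L.+1 | (j <= k)%N && (hspin (i, true) k == plus)]|)%N.

End State.

(* With the 0-based index k, the parts of lambda + rho are lambda_k + r - k. *)
Definition top_spin r (lambda : r.-tuple nat) (j : 'I_(ncols lambda)) : spin :=
  if [exists k : 'I_r, (ncols lambda - j == tnth lambda k + r - k)%N]
  then minus else plus.

Definition admissible r (lambda : r.-tuple nat) (s : state r (ncols lambda)) :
    bool :=
  [&& [forall p, hspin s p ord0 == plus],
      [forall j, vspin s ord_max j == plus],
      [forall j, vspin s ord0 j == top_spin j],
      [forall i, hspin s (i, false) ord_max != hspin s (i, true) ord_max]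
    & [forall p, forall j, isSome (vertex_at s p j)]].

Section Weights.
Variables (F : fieldType) (n : nat) (g : int -> F) (v : F).

Definition delta (a : int) : F := (n%:Z %| a)%Z%:R.
Definition h (a : int) : F := (1 - v) * delta a.

Definition delta_weight (x : F) (a : int) (t : vertex_config) : F :=
  match t with
  | A1 => 1
  | A2 => g a * x
  | B1 => 1
  | B2 => x
  | C1 => h a * x
  | C2 => delta a
  end.

Definition gamma_weight (x : F) (a : int) (t : vertex_config) : F :=
  match t with
  | A1 => 1
  | A2 => x^-1
  | B1 => g a
  | B2 => x^-1
  | C1 => h a * x^-1
  | C2 => delta a
  end.

(* [l] is the spin of the edge on the Delta row; in an admissible state the
   other edge of the bend has the opposite spin. *)
Definition bend_weight (x : F) (a : int) (l : spin) : F :=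
  if l == minus then g (2 * a) * x else x^-1.

(* The default 0 is never reached on an admissible state. *)
Definition wt r L (z : 'I_r -> F) (s : state r L) : F :=
  \prod_(i < r)
   ((\prod_(j < L)
      oapp (delta_weight (z i) (delta_charge s i (left_edge j))) 0
           (vertex_at s (i, false) j))
    * bend_weight (z i) (bend_charge s i) (hspin s (i, false) ord_max)
    * \prod_(j < L)
      oapp (gamma_weight (z i) (gamma_charge s i (right_edge j))) 0
           (vertex_at s (i, true) j)).

Definition left_charges r L (c : 'I_r -> int) (s : state r L) : bool :=
  [forall k, ((gamma_charge s k ord0)%:Z == c k %[mod n%:Z])%Z].

Definition partition_function r (lambda : r.-tuple nat) (z : 'I_r -> F)
    (c : 'I_r -> int) : F :=
  \sum_(s : state r (ncols lambda) | admissible s && left_charges c s) wt z s.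

End Weights.

(* Main.v *)
Require Import Defs.
From mathcomp Require Import all_boot all_order all_algebra.
From mathcomp Require Import reals complex.
From mathcomp Require Import zify ring.

Import Order.TTheory GRing.Theory Num.Theory.
Local Open Scope ring_scope.

(* Only the last row pair involves z_r and c_r.  Spin conservation forces the -
   spins in this pair to form a single path, entering from the top in some
   column, following the Delta row, and then either turning down into the Gamma
   row or leaving through the bend.  Moving the turning point leaves the rest of
   the state unchanged, so the partition function is a sum, over what happens
   above the last pair, of one-path sums.  If the path enters in the column
   numbered m, this sum vanishes unless c_r - N is m or -m modulo n: the first
   residue selects the path through the bend, of weight g(2m) z^m, and the
   second the remaining paths, whose weights form a geometric sum in z^(2n).
   The functional equation then holds separately for each one-path sum. *)

(** * Products and cardinals over an interval of ordinals *)

Lemma prod_if_interval (R : comNzRingType) (x : R) (a b m : nat) : (b <= m)%N ->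
  \prod_(i < m) (if (a <= i < b)%N then x else 1) = x ^+ (b - a).
Proof.
move=> lebm; rewrite -big_mkcond /=.
rewrite -(big_ord_widen_cond m (leq a) (fun=> x) lebm)
  -[LHS](big_geq_mkord a b xpredT (fun=> x)).
by rewrite prodr_const_nat.
Qed.

Lemma prod_if_eq (R : comNzRingType) (y : R) (k m : nat) :
  \prod_(i < m) (if i == k :> nat then y else 1) = if (k < m)%N then y else 1.
Proof.
case: ltnP => km.
  rewrite (bigD1 (Ordinal km)) //= eqxx big1 ?mulr1 // => i.
  by rewrite -val_eqE /= => /negPf->.
by rewrite big1 // => i _; rewrite ifN // ltn_eqF // (leq_trans _ km).
Qed.

Lemma card_ord_interval (a b m : nat) : (b <= m)%N ->
  #|[set i : 'I_m | (a <= i < b)%N]| = (b - a)%N.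
Proof.
move=> lebm; rewrite -sum1dep_card.
rewrite -(big_ord_widen_cond m (leq a) (fun=> 1)%N lebm)
  -[LHS](big_geq_mkord a b xpredT (fun=> 1%N)).
by rewrite sum_nat_const_nat muln1.
Qed.

(** * One-path sums and their functional equation *)

Section LastPairSum.
Variables (F : fieldType) (n : nat) (g : int -> F) (v : F).
Hypotheses (n_odd : odd n) (g_periodic : forall a : int, g (a + n%:Z) = g a)
  (g_0 : g 0 = - v)
  (g_mul : forall a : int, ~~ (n%:Z %| a)%Z -> g a * g (n%:Z - a) = v).

Lemma eq_of_mul_close (t u k : int) : 0 < k -> - k < t * k - u * k < k -> t = u.
Proof. by move=> k0 tu; have [tu0|tu0|//] := ltrgtP t u; nia. Qed.

(** The form in which field identities are proved modulo a vanishing relation [c = 0], with an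
    explicit cofactor [k]. *)
Lemma eq_of_subr_mul (a b k c : F) : c = 0 -> a - b = k * c -> a = b.
Proof. by move=> -> /eqP; rewrite mulr0 subr_eq0 => /eqP. Qed.

Definition geom (y : F) (q : nat) : F := \sum_(t < q.+1) y ^+ t.

Lemma geom_telescope y q : (1 - y) * geom y q = 1 - y ^+ q.+1.
Proof. by rewrite -[1 - y]opprB mulNr -subrX1 opprB. Qed.

Lemma geom_inv y q : y != 0 -> y ^+ q * geom y^-1 q = geom y q.
Proof.
move=> y0; rewrite /geom [RHS](reindex_inj rev_ord_inj) mulr_sumr /=.
apply: eq_bigr => t _; rewrite subSS exprVn.
have /subnK {1}<- : (t <= q)%N by rewrite -ltnS.
by rewrite exprD mulfK // expf_neq0.
Qed.

Lemma sum_multiples (y : F) (m : nat) :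
  \sum_(i < m.+1) (n %| i)%:R * y ^+ i = geom (y ^+ n) (m %/ n).
Proof.
elim: m => [|m IHm].
  by rewrite div0n /geom !big_ord1 dvdn0 mul1r !expr0.
rewrite big_ord_recr /= IHm divnS ?odd_gt0 //.
case: dvdnP => [[q mE]|_]; last by rewrite mul0r addr0.
have n0 := odd_gt0 n_odd.
have dE : (m %/ n).+1 = q.
  by have := divnS m n0; rewrite mE dvdn_mull // mulnK // => ->.
rewrite add1n /geom [RHS]big_ord_recr /= mul1r; congr (_ + _).
by rewrite -exprM dE mE mulnC.
Qed.

Lemma g_add_mul (a t : int) : g (a + t * n%:Z) = g a.
Proof.
have gn k b : g (b + k%:Z * n%:Z) = g b.
  elim: k b => [|k IHk] b; first by rewrite mul0r addr0.
  by rewrite intS mulrDl mul1r addrA [LHS]IHk g_periodic.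
case: t => k; first exact: gn.
by rewrite NegzE mulNr -[LHS](gn k.+1) subrK.
Qed.

Lemma g_mod (a b : int) : (n%:Z %| a - b)%Z -> g a = g b.
Proof. by case/dvdzP=> t E; rewrite -(g_add_mul b t) -E addrC subrK. Qed.

(* The paths entering the last pair [m] columns from the right; [a] is the
   prescribed charge minus [N].  The first summand gathers the paths leaving
   through the Gamma row, the second is the path through all of the Delta row. *)
Definition last_sum (x : F) (m : nat) (a : int) : F :=
  (n%:Z %| m%:Z + a)%Z%:R
     * (x ^- m * (v + (1 - v) * geom (x ^+ 2 ^+ n) (m.-1 %/ n)))
  + (n%:Z %| m%:Z - a)%Z%:R * (g (2 * m%:Z) * x ^+ m).

Lemma last_sum_mod x m a b : (a = b %[mod n%:Z])%Z ->
  last_sum x m a = last_sum x m b.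
Proof.
move=> /eqP; rewrite eqz_mod_dvd => ab; rewrite /last_sum.
have -> : m%:Z + a = (m%:Z + b) + (a - b) by ring.
have -> : m%:Z - b = (m%:Z - a) + (a - b) by ring.
by rewrite !(rpredDr _ ab).
Qed.

(** Put [w = x ^+ n], [W = w ^+ q] and [d = x ^+ e]. Whenever some term survives, [x ^+ m] is a
    monomial in these: [W * w] if [e = 0], [W * d] if [m] is [e] modulo [n], and [W * w / d] if [m]
    is [- e]. What remains is a rational identity modulo the formula for a geometric sum. *)
Lemma last_sum_identity (x : F) (m e : nat) :
    x != 0 -> (0 < m)%N -> (e < n)%N ->
  (1 - v) * (x ^+ n * x ^- (2 * e)) * last_sum x m e%:Z
  + g (2 * e%:Z) * (x ^- n - x ^+ n) * last_sum x m (- e%:Z)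
  = (x ^- n - v * x ^+ n) * last_sum x^-1 m e%:Z.
Proof.
move=> x0 m0 en; rewrite /last_sum opprK.
set q := (m.-1 %/ n)%N.
have mE : m = (q * n + m.-1 %% n).+1 by rewrite -divn_eq prednK.
have n0 := odd_gt0 n_odd.
have rn : (m.-1 %% n < n)%N by rewrite ltn_mod.
have x20 : x ^+ 2 ^+ n != 0 by rewrite !expf_neq0.
have GI := geom_inv _ q x20; have GT := geom_telescope (x ^+ 2 ^+ n) q.
rewrite !exprVn in GI *; rewrite -/q.
move: GI GT; set G := geom _ q; set G' := geom _ q => GI GT.
set w := x ^+ n in GI GT *; set p := x ^+ m.
have w0 : w != 0 by rewrite expf_neq0.
have wE : x ^+ 2 ^+ n = w ^+ 2 by rewrite -!exprM mulnC.
rewrite wE in GI GT.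
have wW : w ^+ 2 ^+ q = (w ^+ q) ^+ 2 by exact: exprAC.
rewrite [_ ^+ q.+1]exprS wW in GT; rewrite wW in GI.
have W0 : w ^+ q != 0 by rewrite expf_neq0.
move: GI GT W0; set W := w ^+ q => GI GT W0.
have -> : G = W ^- 2 * G' by rewrite -GI mulKf // expf_neq0.
(* Each case below is a field identity up to a multiple of this relation. *)
have eps0 : (1 - w ^+ 2) * G' - 1 + w ^+ 2 * W ^+ 2 = 0 by rewrite GT; ring.
(* Since [q * n < m <= q.+1 * n] and [e < n], a multiple [t * n] equal to [m + e] has [t = q + 1];
   if [0 < e], one equal to [m - e] has [t = q]. *)
have close t : - n%:Z < t * n%:Z - (q%:Z + 1) * n%:Z < n%:Z -> t = q%:Z + 1.
  by apply: eq_of_mul_close; lia.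
have close' t : - n%:Z < t * n%:Z - q%:Z * n%:Z < n%:Z -> t = q%:Z.
  by apply: eq_of_mul_close; lia.
have [e0|e0] := posnP e.
  have [/dvdnP[t mt]|nd] := boolP (n %| m)%N; last first.
    have -> : (n%:Z %| m%:Z + e%:Z)%Z = false by rewrite e0 addr0; apply/negbTE.
    have -> : (n%:Z %| m%:Z - e%:Z)%Z = false by rewrite e0 subr0; apply/negbTE.
    by rewrite !(mul0r, addr0, mulr0).
  have -> : (n%:Z %| m%:Z + e%:Z)%Z by rewrite e0 addr0; apply/dvdnP; exists t.
  have -> : (n%:Z %| m%:Z - e%:Z)%Z by rewrite e0 subr0; apply/dvdnP; exists t.
  have mq : m = (q.+1 * n)%N.
    have tq : t%:Z = q%:Z + 1 by apply: close; lia.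
    by rewrite {1}mt; congr (_ * n)%N; lia.
  have -> : p = W * w by rewrite /p mq mulnC exprM exprSr.
  have -> : g (2 * e%:Z) = - v by rewrite e0 mulr0 g_0.
  have -> : g (2 * m%:Z) = - v.
    by rewrite mq -g_0; apply: g_mod; rewrite subr0 PoszM mulrA dvdz_mull.
  rewrite e0 muln0 expr0 invr1 !mulr1 !mul1r invrK.
  apply: (eq_of_subr_mul _ _
    (- v * (1 - v) * (1 + w ^+ 2) / (W * w ^+ 2)) _ eps0).
  by field; rewrite w0 W0.
have d0 : x ^+ e != 0 by rewrite expf_neq0.
rewrite mulnC exprM; move: d0; set d := x ^+ e => d0.
(* As [n] is odd and [0 < e < n], the residues [e] and [- e] are distinct, and [g_mul] applies to
   [2 * e]. *)
have nd2e : ~~ (n %| 2 * e)%N.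
  by rewrite Gauss_dvdr ?coprimen2 // gtnNdvd.
have [d1|nd1] := boolP (n%:Z %| m%:Z - e%:Z)%Z.
  have -> : (n%:Z %| m%:Z + e%:Z)%Z = false.
    apply: contraNF nd2e => d2; change (n%:Z %| (2 * e)%N%:Z)%Z.
    have -> : (2 * e)%N%:Z = (m%:Z + e%:Z) - (m%:Z - e%:Z) by lia.
    exact: rpredB.
  rewrite -(@g_mod (2 * m%:Z) (2 * e%:Z)); last first.
    by rewrite -mulrBr dvdz_mull.
  have -> : p = W * d.
    suff -> : p = x ^+ (n * q + e) by rewrite exprD exprM.
    case/dvdzP: d1 => t te; congr (_ ^+ _).
    have tq : t = q%:Z by apply: close'; lia.
    by rewrite tq in te; lia.
  rewrite !mul0r !mul1r !add0r addr0.
  apply: (eq_of_subr_mul _ _ ((1 - v) * g (2 * m%:Z) / (W * d * w)) _ eps0).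
  by field; rewrite w0 W0 d0.
have [d2|nd2] := boolP (n%:Z %| m%:Z + e%:Z)%Z; last first.
  by rewrite !(mul0r, addr0, mulr0).
have gg : g (2 * e%:Z) * g (2 * m%:Z) = v.
  rewrite -(g_mul (2 * e%:Z)) //; congr (_ * _); apply: g_mod.
  have -> : 2 * m%:Z - (n%:Z - 2 * e%:Z) = 2 * (m%:Z + e%:Z) - n%:Z by ring.
  by rewrite rpredB // dvdz_mull.
have -> : p = W * w / d.
  apply: (mulIf d0); rewrite mulfVK // /p /d -exprD -exprSr -exprM.
  case/dvdzP: d2 => t te; congr (_ ^+ _).
  have tq : t = q%:Z + 1 by apply: close; lia.
  by rewrite tq in te; lia.
rewrite !mul0r !mul1r !add0r addr0 invrK.
apply: (eq_of_subr_mul _ _ (- v * (1 - v) / (W * d)) _ eps0).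
by rewrite -gg; field; rewrite w0 W0 d0.
Qed.

(** The lines are the Delta row, the bend and the Gamma row of a path entering at [j] and turning
    down at [k]. The vertex at [j] in the Delta row contributes 1, being [B1] or a [C2] of charge
    0. *)
Definition path_weight (x : F) (L j k : nat) : F :=
  x ^+ (k - j.+1) * (if (j < k < L)%N then h n v (k - j)%N * x else 1)
  * (if (k < L)%N then x^-1 else g (2 * (k - j)%N%:Z) * x)
  * ((if (k < L)%N then delta F n (k - j)%N else 1) * x^-1 ^+ (L - k.+1)).

(** Each step of the turning point to the right trades a factor [x^-1] of the Gamma row for a factor
    [x] of the Delta row, whence [x ^+ 2]. The [C1] and [C2] vertices at the turn have the same
    charge [i], so their divisibility indicators merge. For [i = 0] there is no [C1], hence no
    [1 - v]. *)
Lemma path_weight_turn x L j i : x != 0 -> (i + j < L)%N ->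
  path_weight x L j (i + j) =
  x ^- (L - j) * ((n %| i)%N%:R * (if i == 0%N then 1 else 1 - v)
                  * (x ^+ 2) ^+ i).
Proof.
move=> x0 ijL; rewrite /path_weight ijL addnK andbT -[X in (X < _)%N]add0n.
rewrite ltn_add2r /h /delta.
have -> : (L - j = i + (L - (i + j).+1).+1)%N by lia.
have -> : (i + j - j.+1 = i.-1)%N by lia.
rewrite exprVn !exprD exprS exprAC expr2.
set D := (n %| i)%N%:R.
have DD : D * D = D by rewrite -natrM mulnb andbb.
have xi0 (k : nat) : x ^+ k != 0 by rewrite expf_neq0.
move: (xi0 (L - (i + j).+1)%N); move: (x ^+ (L - (i + j).+1)) => X X0.
case: (posnP i) => [->|i0].
  by rewrite !expr0; field; rewrite x0 X0.
rewrite -(prednK i0) /= exprS -[in RHS]DD.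
by field; rewrite x0 X0 xi0.
Qed.

(** The term [k = L] is the path through the bend. For [k = i + j < L] the charge condition involves
    [2 * i], but the weight vanishes unless [n] divides [i], so the condition no longer depends on
    [i] and comes out of the sum. *)
Lemma sum_path_weight x L j (c : int) : x != 0 -> (j < L)%N ->
  \sum_(k < L.+1 | (j <= k)%N)
     ((((k - j) + k.+1)%N%:Z == c %[mod n%:Z])%Z)%:R * path_weight x L j k
  = last_sum x (L - j) (c - L.+1%:Z).
Proof.
move=> x0 jL; rewrite big_mkcond big_ord_recr /= (ltnW jL) /last_sum.
congr (_ + _); last first.
  rewrite eqz_mod_dvd; congr ((_ %| _)%Z%:R * _); first by lia.
  rewrite /path_weight ltnn andbF mulr1 mul1r.
  have -> : (L - L.+1 = 0)%N by lia.
  by rewrite expr0 mulr1 mulrCA -exprSr; congr (_ * _ ^+ _); lia.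
rewrite -big_mkcond /=.
set f := fun k : nat => ((((k - j) + k.+1)%N%:Z == c %[mod n%:Z])%Z)%:R *
  path_weight x L j k.
rewrite -[LHS](big_geq_mkord j L xpredT f) -[X in \sum_(X <= _ < _) _]add0n.
rewrite big_addn big_mkord.
have m0 : (0 < L - j)%N by rewrite subn_gt0.
(* The term [i = 0] has coefficient 1 instead of [1 - v]; the difference is the isolated [v]. *)
have <- : \sum_(i < L - j) (n %| i)%N%:R *
      (if i == 0%N :> nat then 1 else 1 - v) * (x ^+ 2) ^+ i = v + (1 - v) * geom (x ^+ 2 ^+ n) ((L - j).-1 %/ n).
  rewrite -sum_multiples prednK // -(prednK m0) !big_ord_recl /=.
  rewrite dvdn0 !expr0 !mul1r mulrDr mulr1 addrA addrC [v + _]addrC subrK addrC.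
  congr (_ + _); rewrite mulr_sumr; apply: eq_bigr => i _.
  by rewrite mulrCA mulrA.
rewrite !mulr_sumr; apply: eq_bigr => i _; rewrite /f.
have iL : (i + j < L)%N by have := ltn_ord i; lia.
rewrite path_weight_turn // eqz_mod_dvd.
have -> : ((i + j - j + (i + j).+1)%N%:Z - c =
   2 * i%:Z - ((L - j)%N%:Z + (c - L.+1%:Z)))%R by lia.
have [ni|nni] := boolP (n %| i)%N; last by rewrite !(mul0r, mulr0).
by congr ((_ : bool)%:R * _); rewrite rpredBl // dvdz_mull.
Qed.

End LastPairSum.

(** * Spins along rows as lattice paths *)

(** With [+] on the bottom only [A1], [B2] and [C2] occur, and none has [-] on the left and [+] on
    the right: the row changes sign at most once, exactly where the top is [-]. The value [k = m]
    means no change. *)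
Lemma row_path (m : nat) (h t : nat -> bool) :
  h 0%N ->
  (forall c, (c < m)%N -> isSome (config_of (h c) (h c.+1) (t c) true)) ->
  exists k, [/\ (k <= m)%N, forall e, (e <= m)%N -> h e = (e <= k)%N
    & forall c, (c < m)%N -> t c = (c != k)].
Proof.
move=> h0; elim: m => [|m IHm] cfg.
  by exists 0%N; split=> // e; rewrite leqn0 => /eqP->.
have [|k [km hE tE]] := IHm; first by move=> c cm; apply: cfg; apply: ltnW.
have extend k' : (k <= k' <= m.+1)%N -> (k' = k \/ k = m) ->
    h m.+1 = (m.+1 <= k')%N -> t m = (m != k') ->
  exists k, [/\ (k <= m.+1)%N, forall e, (e <= m.+1)%N -> h e = (e <= k)%N
    & forall c, (c < m.+1)%N -> t c = (c != k)].
  move=> /andP[kk' k'm] kE hm tm; exists k'; split=> // [e|c].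
    by rewrite leq_eqVlt => /predU1P[->//|em]; rewrite hE //; lia.
  by rewrite ltnS leq_eqVlt => /predU1P[->//|cm]; rewrite tE //; lia.
have := cfg m (leqnn _); rewrite (hE m) //.
have [km'|km'] := ltnP k m.
  case hm: (h m.+1); case tm: (t m) => // _.
  by apply: (extend k); rewrite ?hm ?tm; [lia|left|lia|lia].
have kE : k = m by lia.
case hm: (h m.+1); case tm: (t m) => // _.
  by apply: (extend m.+1); rewrite ?hm ?tm; [lia|right|lia|lia].
by apply: (extend m); rewrite ?hm ?tm; [lia|right|lia|lia].
Qed.

(** [row_path] on the Gamma row yields [k], so the spins between the two rows are [+] left of [k],
    and [row_path] applies again to that part of the Delta row, yielding [j]. The bend settles the
    rest: for [k = L] it forces the path to have entered, and for [k < L] it forbids a second path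
    to the right of [k]. *)
Lemma row_pair_path (L : nat) (hD hG t m : nat -> bool) :
  hD 0%N -> hG 0%N -> hD L != hG L ->
  (forall c, (c < L)%N -> isSome (config_of (hD c) (hD c.+1) (t c) (m c))) ->
  (forall c, (c < L)%N -> isSome (config_of (hG c) (hG c.+1) (m c) true)) ->
  exists j k, [/\ (j <= k)%N, (k <= L)%N & (j < L)%N] /\
    [/\ forall e, (e <= L)%N -> hD e = ~~ (j < e <= k)%N,
        forall e, (e <= L)%N -> hG e = (e <= k)%N,
        forall c, (c < L)%N -> t c = (c != j)
      & forall c, (c < L)%N -> m c = (c != k)].
Proof.
move=> hD0 hG0 bend cfgD /(row_path _ _ _ hG0)[k [kL hGE mE]].
have [|j [jk hDE tE]] := row_path k hD t hD0.
  move=> c ck; have cL := leq_trans ck kL.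
  by have := cfgD c cL; rewrite mE // (ltn_eqF ck).
move: bend; rewrite hGE //; have [kL'|Lk] := ltnP k L; last first.
  have kE : k = L by lia.
  subst k; rewrite hDE // eqb_id -ltnNge => jL; exists j, L.
  split; first by split=> //; lia.
  by split=> // e eL; rewrite hDE //; lia.
rewrite eqbF_neg negbK => hDL.
(* Induction from the bend leftwards: [+] on the right and on the bottom leaves only [A1]. *)
have after d : (d < L - k)%N -> hD (L - d)%N /\ (d != 0%N -> t (L - d)%N).
  elim: d => [|d IHd] dL; first by split=> //; rewrite subn0.
  have [] := IHd (ltnW dL) => hd _.
  have cL : (L - d.+1 < L)%N by lia.
  have := cfgD _ cL; rewrite mE // (_ : (L - d.+1).+1 = L - d)%N; last by lia.
  rewrite hd (_ : _ != k); last by lia.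
  by case: (hD _); case: (t _).
have afterD e : (k < e <= L)%N -> hD e.
  by move=> ke; have [|+ _] := after (L - e)%N; [lia | rewrite subKn //; lia].
have afterT c : (k < c < L)%N -> t c.
  move=> kc; have [|_] := after (L - c)%N; first by lia.
  by rewrite (_ : L - (L - c) = c)%N; [apply; lia | lia].
have tk : t k = (k != j).
  have := cfgD k kL'; rewrite mE // eqxx /= (afterD k.+1); last by lia.
  rewrite hDE //; have [->|kj] := eqVneq k j.
    by rewrite leqnn; case: (t j).
  by rewrite (_ : (k <= j)%N = false); [case: (t k) | lia].
exists j, k; split; first by split=> //; lia.
split=> // [e eL|c cL].
  have [ek|ke] := leqP e k; first by rewrite hDE //; lia.
  by rewrite afterD; lia.
have [ck|kc|->] := ltngtP c k; first by rewrite tE.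
  by rewrite afterT; lia.
exact: tk.
Qed.

(** * The path in the last row pair of a state *)

Section LastPair.
Variables (r : nat) (lambda : r.-tuple nat) (l : 'I_r).
Hypothesis l_last : l.+1 = r.
Notation L := (ncols lambda).
Implicit Types (s u : state r L) (p : lattice_row r) (j k : nat).

Lemma top_edgeE p : top_edge p = (p.1.*2 + p.2)%N :> nat.
Proof. by rewrite inordK //; have := ltn_ord p.1; case: p.2; lia. Qed.

Lemma bottom_edgeE p : bottom_edge p = (p.1.*2 + p.2).+1 :> nat.
Proof. by rewrite inordK //; have := ltn_ord p.1; case: p.2; lia. Qed.

Lemma bottom_delta_edge (i : 'I_r) :
  bottom_edge (i, false) = top_edge (i, true).
Proof. by apply: val_inj; rewrite /= bottom_edgeE top_edgeE /=; lia. Qed.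

Lemma bottom_last_edge : bottom_edge (l, true) = ord_max.
Proof. by apply: val_inj; rewrite /= bottom_edgeE /=; lia. Qed.

(* In the last row pair of an admissible state the [-] spins form one path: it
   enters from the top in column [j], follows the Delta row up to column [k],
   and from there the Gamma row; for [k = L] it leaves through the bend from
   the Delta row. *)
Definition turn_path s j k :=
  [/\ forall e, hspin s (l, false) e = ~~ (j < e <= k)%N,
      forall e, hspin s (l, true) e = (e <= k)%N,
      forall c, vspin s (top_edge (l, false)) c = (c != j :> nat)
    & forall c, vspin s (top_edge (l, true)) c = (c != k :> nat)].

(** Level [l.*2.+1] lies between the two rows of the last pair; the edges above the pair, which fix
    the entry column, must agree. *)
Definition agree_off_last s s' :=
  (forall p e, p.1 != l -> hspin s p e = hspin s' p e) /\
  (forall (q : 'I_(r.*2).+1) c, q != l.*2.+1 :> nat ->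
     vspin s q c = vspin s' q c).

Definition with_turn s j k : state r L :=
  ([ffun x : lattice_row r * 'I_L.+1 =>
      if x.1.1 == l then
        if x.1.2 then (x.2 <= k)%N else ~~ (j < x.2 <= k)%N
      else s.1 x],
   [ffun x : 'I_(r.*2).+1 * 'I_L =>
      if x.1 == l.*2.+1 :> nat then x.2 != k :> nat else s.2 x]).

Lemma agree_with_turn s j k : agree_off_last s (with_turn s j k).
Proof.
split=> [p e pl|q c ql]; first by rewrite /hspin ffunE /= (negbTE pl).
by rewrite /vspin ffunE /= (negbTE ql).
Qed.

Lemma with_turn_path s j k :
    (forall c, vspin s (top_edge (l, false)) c = (c != j :> nat)) ->
  turn_path (with_turn s j k) j k.
Proof.
move=> top; split=> [e|e|c|c]; rewrite /hspin /vspin ffunE /= ?eqxx //.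
  by rewrite top_edgeE /= ifN; [exact: top | lia].
by rewrite top_edgeE /= ifT //; lia.
Qed.

Lemma state_eq s s' j k : agree_off_last s s' -> turn_path s j k ->
  turn_path s' j k -> s = s'.
Proof.
move=> [hA vA] [hD hG _ m] [hD' hG' _ m'].
suff [hE vE] : s.1 = s'.1 /\ s.2 = s'.2.
  by move: hE vE; case: (s) => ? ?; case: (s') => ? ? /= -> ->.
split; apply/ffunP => -[].
  move=> p e; have [|pl] := eqVneq p.1 l; last exact: hA.
  by case: p => i [] /= ->; [have := hG e | have := hD e];
    rewrite /hspin => ->; rewrite ?hD' ?hG'; [rewrite -hG'|rewrite -hD'].
move=> q c; have [ql|ql] := eqVneq (q : nat) l.*2.+1; last exact: vA.
have -> : q = top_edge (l, true).
  by apply: val_inj; rewrite /= top_edgeE ql /=; lia.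
by have := m c; rewrite /vspin => ->; rewrite -m'.
Qed.

Lemma turn_path_inj s j k j' k' : (j < L)%N -> (k <= L)%N -> (j' < L)%N ->
    (k' <= L)%N ->
  turn_path s j k -> turn_path s j' k' -> j = j' /\ k = k'.
Proof.
move=> jL kL j'L k'L [_ hG top _] [_ hG' top' _]; split.
  by have := top (Ordinal jL); rewrite top' eqxx => /negbFE/eqP.
have kk : (k < L.+1)%N by []. have kk' : (k' < L.+1)%N by [].
have := hG (Ordinal kk); have := hG' (Ordinal kk'); rewrite hG hG' /= !leqnn.
lia.
Qed.

Lemma admissible_turn_path s : admissible s ->
  exists j k, [/\ (j <= k)%N, (k <= L)%N & (j < L)%N] /\ turn_path s j k.
Proof.
case/and5P=> /forallP left /forallP bottom _ /forallP bend /forallP cfg.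
(* The spins are extended to all naturals to fit [row_pair_path]; the values out of range are never
   consulted. *)
pose hD e := hspin s (l, false) (inord e).
pose hG e := hspin s (l, true) (inord e).
pose t c := oapp (vspin s (top_edge (l, false))) true (insub c).
pose m c := oapp (vspin s (top_edge (l, true))) true (insub c).
have hE p (c : 'I_L) : (hspin s p (inord c) = hspin s p (left_edge c))
    * (hspin s p (inord c.+1) = hspin s p (right_edge c)).
  split; congr hspin; apply: val_inj;
    by rewrite /= inordK // ltnS ?ltn_ord // ltnW.
have [|||c cL|c cL|j [k [jk [hDE hGE tE mE]]]] := @row_pair_path L hD hG t m.
- have := left (l, false); rewrite /hD (_ : inord 0 = ord0); first by move/eqP.
  by apply: val_inj; rewrite /= inordK.
- have := left (l, true); rewrite /hG (_ : inord 0 = ord0); first by move/eqP.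
  by apply: val_inj; rewrite /= inordK.
- have := bend l; rewrite /hD /hG (_ : inord L = ord_max) //.
  by apply: val_inj; rewrite /= inordK.
- have /forallP/(_ (Ordinal cL)) := cfg (l, false).
  rewrite /vertex_at bottom_delta_edge -!hE /=.
  by rewrite /t /m insubT.
- have /forallP/(_ (Ordinal cL)) := cfg (l, true).
  rewrite /vertex_at bottom_last_edge (eqP (bottom _)) -!hE /=.
  by rewrite /m insubT.
exists j, k; split=> //; split=> [e|e|c|c].
- by have := hDE e; rewrite /hD inord_val => -> //; rewrite -ltnS.
- by have := hGE e; rewrite /hG inord_val => -> //; rewrite -ltnS.
- by have := tE c (ltn_ord c); rewrite /t valK.
- by have := mE c (ltn_ord c); rewrite /m valK.
Qed.

Lemma turn_delta_vertex s j k c : (j <= k)%N -> turn_path s j k ->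
  vertex_at s (l, false) c =
  Some (if (c < j)%N then A1 else if c == j :> nat then
          if k == j then B1 else C2
        else if (c < k)%N then B2 else if c == k :> nat then C1 else A1).
Proof.
move=> jk [hD _ t m]; rewrite /vertex_at bottom_delta_edge t m !hD.
rewrite /left_edge /right_edge /= /bump /= add1n ltnS.
case: (ltngtP c j) => [cj|cj|->] /=; last first.
  rewrite (eq_sym k).
  by case: (ltngtP j k) jk.
  by case: (ltngtP c k).
by rewrite ltn_eqF // (leq_trans cj).
Qed.

Lemma turn_gamma_vertex s j k c : (forall c, vspin s ord_max c) ->
  turn_path s j k ->
  vertex_at s (l, true) c =
  Some (if (c < k)%N then A1 else if c == k :> nat then C2 else B2).
Proof.
move=> b [_ hG _ m]; rewrite /vertex_at bottom_last_edge b m !hG.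
rewrite /left_edge /right_edge /= /bump /= add1n.
by case: (ltngtP c k).
Qed.

Lemma turn_delta_charge s j k e : turn_path s j k ->
  delta_charge s l e = (minn e k - j)%N.
Proof.
move=> [hD _ _ _]; rewrite /delta_charge.
have -> : [set x : 'I_L.+1 | (x <= e)%N & hspin s (l, false) x == false]
    = [set x : 'I_L.+1 | (j.+1 <= x < (minn e k).+1)%N].
  by apply/setP => x; rewrite !inE hD; lia.
by rewrite card_ord_interval ?subSS // ltnS geq_min -ltnS ltn_ord.
Qed.

Lemma turn_bend_charge s j k : (k <= L)%N -> turn_path s j k ->
  bend_charge s l = (k - j)%N.
Proof.
move=> kL tp; rewrite /bend_charge (turn_delta_charge _ _ _ _ tp) /=.
by rewrite (minn_idPr kL).
Qed.

Lemma turn_gamma_charge s j k e : (k <= L)%N -> turn_path s j k ->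
  gamma_charge s l e = ((k - j) + (k.+1 - e))%N.
Proof.
move=> kL tp; rewrite /gamma_charge (turn_bend_charge _ _ _ kL tp).
have [_ hG _ _] := tp; congr (_ + _)%N.
have -> : [set x : 'I_L.+1 | (e <= x)%N & hspin s (l, true) x == true]
    = [set x : 'I_L.+1 | (e <= x < k.+1)%N].
  by apply/setP => x; rewrite !inE hG; lia.
by rewrite card_ord_interval.
Qed.

(* On an admissible state these are the [k] and [j] of [turn_path], read off
   from the charges. *)
Definition turn s : nat := (gamma_charge s l ord0 - bend_charge s l).-1.
Definition entry s : nat := (turn s - bend_charge s l)%N.

Lemma turnE s j k : (j <= k)%N -> (k <= L)%N -> turn_path s j k ->
  turn s = k /\ entry s = j.
Proof.
move=> jk kL tp; rewrite /entry /turn (turn_bend_charge _ _ _ kL tp).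
by rewrite (turn_gamma_charge _ _ _ _ kL tp) /=; lia.
Qed.

(** * Changing a state only in the last row pair *)

Section AgreeOffLast.
Variables (s s' : state r L).
Hypothesis agr : agree_off_last s s'.

Lemma agree_vertex p c : p.1 != l -> vertex_at s p c = vertex_at s' p c.
Proof.
move=> pl; have [hA vA] := agr; rewrite /vertex_at !hA // !vA //;
  rewrite ?top_edgeE ?bottom_edgeE.
all: have pl' : p.1 != l :> nat by [].
all: by case: p pl' {pl} => i [] /= ? ; have := ltn_ord i; lia.
Qed.

Lemma agree_delta_charge i e : i != l ->
  delta_charge s i e = delta_charge s' i e.
Proof.
move=> il; apply: eq_card => x; rewrite !inE; have [hA _] := agr.
by rewrite hA.
Qed.

Lemma agree_gamma_charge i e : i != l ->
  gamma_charge s i e = gamma_charge s' i e.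
Proof.
move=> il; rewrite /gamma_charge /bend_charge agree_delta_charge //.
congr (_ + _)%N; apply: eq_card => x; rewrite !inE; have [hA _] := agr.
by rewrite hA.
Qed.

End AgreeOffLast.

(** Every vertex of the last pair along a path with [j <= k] is one of the six, and the bend has
    opposite spins both for [k < L] and for [k = L], so the turning point is free. *)
Lemma admissible_with_turn s s' j k : admissible s -> agree_off_last s s' ->
    (j <= k)%N -> (k <= L)%N -> (j < L)%N -> turn_path s' j k ->
  admissible s'.
Proof.
case/and5P=> /forallP left /forallP bottom /forallP top /forallP bend.
move=> /forallP cfg agr jk kL jL tp; have [hA vA] := agr; have [hD hG _ _] := tp.
have b c : vspin s' ord_max c by rewrite -vA ?(eqP (bottom c)) //=; lia.
apply/and5P; split; apply/forallP.
- move=> p; have [|pl] := eqVneq p.1 l; last by rewrite -hA.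
  by case: p => i [] /= ->; rewrite ?hG ?hD //= ltn0.
- by move=> c; rewrite b.
- by move=> c; rewrite -vA.
- move=> i; have [->|il] := eqVneq i l; last by rewrite -!hA.
  by rewrite hD hG /= jL /=; case: (L <= k)%N.
move=> p; apply/forallP => c; have [|pl] := eqVneq p.1 l; last first.
  by rewrite -(agree_vertex _ _ agr) //; have /forallP := cfg p.
case: p => i [] /= ->; first by rewrite (turn_gamma_vertex _ _ _ _ b tp).
by rewrite (turn_delta_vertex _ _ _ _ jk tp).
Qed.

Lemma admissible_turnP s : admissible s ->
  [/\ (entry s <= turn s)%N, (turn s <= L)%N, (entry s < L)%N
    & turn_path s (entry s) (turn s)].
Proof.
move=> sA; have [j [k [[jk kL jL] tp]]] := admissible_turn_path s sA.
by have [-> ->] := turnE _ _ _ jk kL tp.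
Qed.

Lemma with_turnP s k : admissible s -> (entry s <= k)%N -> (k <= L)%N ->
  let s' := with_turn s (entry s) k in
  [/\ admissible s', turn s' = k, entry s' = entry s
    & turn_path s' (entry s) k].
Proof.
move=> sA jk kL s'; have [_ _ jL [_ _ top _]] := admissible_turnP s sA.
have tp : turn_path s' (entry s) k by exact: with_turn_path.
have [tE eE] := turnE _ _ _ jk kL tp; split=> //.
apply: (admissible_with_turn s s' _ _ sA _ jk kL jL tp).
exact: agree_with_turn.
Qed.

Lemma with_turnK s j k k' : with_turn (with_turn s j k) j k' = with_turn s j k'.
Proof.
congr pair; apply/ffunP => x; rewrite !ffunE.
  by case: eqP => // xl; rewrite ffunE; case: eqP xl.
by case: eqP => // xl; rewrite ffunE; case: eqP xl.
Qed.

Lemma with_turn_id s : admissible s -> with_turn s (entry s) (turn s) = s.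
Proof.
move=> sA; have [jk kL _ tp] := admissible_turnP s sA.
have [_ _ _ tp'] := with_turnP s _ sA jk kL.
by apply/esym/(state_eq _ _ _ _ _ tp tp'); apply: agree_with_turn.
Qed.

(** * Factorisation of the weights and of the partition function *)

Section Weight.
Variables (F : fieldType) (n : nat) (g : int -> F) (v : F).

Definition pair_weight (x : F) s (i : 'I_r) : F :=
  (\prod_(c < L)
      oapp (delta_weight n g v x (delta_charge s i (left_edge c))) 0
           (vertex_at s (i, false) c))
    * bend_weight g x (bend_charge s i) (hspin s (i, false) ord_max)
    * \prod_(c < L)
      oapp (gamma_weight n g v x (gamma_charge s i (right_edge c))) 0
           (vertex_at s (i, true) c).

Lemma agree_pair_weight s s' x i : agree_off_last s s' -> i != l ->
  pair_weight x s i = pair_weight x s' i.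
Proof.
move=> agr il; rewrite /pair_weight; congr (_ * _ * _).
- apply: eq_bigr => c _.
  by rewrite (agree_vertex _ _ agr) ?(agree_delta_charge _ _ agr).
- by rewrite /bend_charge (agree_delta_charge _ _ agr) // (proj1 agr).
- apply: eq_bigr => c _.
  by rewrite (agree_vertex _ _ agr) ?(agree_gamma_charge _ _ agr).
Qed.

Lemma turn_pair_weight s j k x : (forall c, vspin s ord_max c) ->
    (j <= k)%N -> (k <= L)%N -> (j < L)%N -> turn_path s j k ->
  pair_weight x s l = path_weight F n g v x L j k.
Proof.
move=> b jk kL jL tp; have [hD hG _ _] := tp; rewrite /pair_weight /path_weight.
congr (_ * _ * _).
- rewrite -(prod_if_interval _ _ j.+1 k L) //.
  (* The single factor of the turn is spread over the columns, so that both sides can be compared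
     vertex by vertex. *)
  have -> : (if (j < k < L)%N then h n v (k - j)%N * x else 1) =
    \prod_(c < L) (if c == k :> nat then
                     if (j < k)%N then h n v (k - j)%N * x else 1 else 1).
    by rewrite prod_if_eq; case: ltnP; case: ltnP.
  rewrite -big_split /=; apply: eq_bigr => c _.
  rewrite (turn_delta_vertex _ _ _ _ jk tp) (turn_delta_charge _ _ _ _ tp) /=.
  case: (ltngtP c j) => [cj|cj|cj] /=.
  + by rewrite ltn_eqF ?mulr1 // (leq_trans cj).
  + case: (ltngtP c k) => [ck|ck|ck] /=; rewrite ?mulr1 //.
    by rewrite ?minnn mul1r -ck cj.
  case: eqVneq => [kj|kj] /=; first by rewrite cj kj eqxx ltnn mulr1.
  rewrite cj eq_sym (negbTE kj) mulr1 (minn_idPl jk) subnn.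
  by rewrite /delta dvdz0.
- rewrite (turn_bend_charge _ _ _ kL tp) hD /bend_weight /= jL /=.
  by rewrite leqNgt; case: (k < L)%N.
rewrite -[x^-1 ^+ _](prod_if_interval _ _ k.+1 L L) //.
have -> : (if (k < L)%N then delta F n (k - j)%N else 1) =
    \prod_(c < L) (if c == k :> nat then delta F n (k - j)%N else 1).
  by rewrite prod_if_eq.
rewrite -big_split /=; apply: eq_bigr => c _.
rewrite (turn_gamma_vertex _ _ _ _ b tp) (turn_gamma_charge _ _ _ _ kL tp) /=.
rewrite ltn_ord andbT; case: (ltngtP c k) => ck; rewrite ?mulr1 ?mul1r //=.
by rewrite /bump add1n ck subnn addn0.
Qed.

(** The charge conditions of the other pairs are built in through the value 0, so that they too
    become a factor. *)
Definition off_last_weight (z : 'I_r -> F) (c : 'I_r -> int) s : F :=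
  if [forall i, (i != l) ==> ((gamma_charge s i ord0)%:Z == c i %[mod n%:Z])%Z]
  then \prod_(i | i != l) pair_weight (z i) s i else 0.

Lemma agree_off_last_weight s s' z c : agree_off_last s s' ->
  off_last_weight z c s = off_last_weight z c s'.
Proof.
move=> agr; rewrite /off_last_weight.
rewrite (eq_bigr _ (fun i => agree_pair_weight s s' (z i) i agr)).
congr (if _ then _ else _); apply: eq_forallb => i.
by have [//|il] := eqVneq i l; rewrite (agree_gamma_charge _ _ agr).
Qed.

Lemma off_last_weight_eq z z' c c' s :
    (forall i, i != l -> z' i = z i) -> (forall i, i != l -> c' i = c i) ->
  off_last_weight z' c' s = off_last_weight z c s.
Proof.
move=> zz cc; rewrite /off_last_weight.
rewrite (eq_bigr (fun i => pair_weight (z i) s i)) => [|i /zz-> //].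
congr (if _ then _ else _); apply: eq_forallb => i.
by have [//|/cc->] := eqVneq i l.
Qed.

Lemma wt_with_turn s k z c : admissible s -> (entry s <= k)%N -> (k <= L)%N ->
  let s' := with_turn s (entry s) k in
  (if left_charges n c s' then wt n g v z s' else 0) =
  off_last_weight z c s *
    ((((k - entry s) + k.+1)%N%:Z == c l %[mod n%:Z])%Z%:R *
     path_weight F n g v (z l) L (entry s) k).
Proof.
move=> sA jk kL s'; have [s'A _ _ tp] := with_turnP s k sA jk kL.
have [_ _ jL _] := admissible_turnP s sA.
have b x : vspin s' ord_max x.
  by case/and5P: s'A => _ /forallP/(_ x)/eqP.
rewrite (agree_off_last_weight s s'); last exact: agree_with_turn.
rewrite /off_last_weight.
have -> : left_charges n c s' =
    (((k - entry s) + k.+1)%N%:Z == c l %[mod n%:Z])%Z &&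
    [forall i, (i != l) ==> ((gamma_charge s' i ord0)%:Z == c i %[mod n%:Z])%Z].
  have gl : gamma_charge s' l ord0 = ((k - entry s) + k.+1)%N.
    by rewrite (turn_gamma_charge _ _ _ _ kL tp) subn0.
  apply/forallP/andP => [cs|[cl /forallP cs] i].
    by split; [rewrite -gl | apply/forallP => i; rewrite cs implybT].
  by have [->|il] := eqVneq i l; [rewrite gl | have := cs i; rewrite il].
case: eqP => _ /=; last by rewrite mul0r mulr0.
case: ifP => _; last by rewrite mul0r.
rewrite mul1r -(turn_pair_weight _ _ _ _ b jk kL jL tp).
by rewrite [LHS](bigD1 l) //= mulrC.
Qed.

Hypothesis n_odd : odd n.

(** States differing only in the turning point form a class, represented by its member whose path
    runs through the bend. The weight off the last pair is constant on a class, and the sum over [k]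
    is [sum_path_weight]. *)
Lemma partition_functionE z c : z l != 0 ->
  partition_function n g v lambda z c =
  \sum_(s | admissible s && (turn s == L))
     off_last_weight z c s *
     last_sum F n g v (z l) (L - entry s) (c l - L.+1%:Z).
Proof.
move=> zl0; rewrite /partition_function big_mkcondr /=.
rewrite (partition_big (fun s => with_turn s (entry s) L)
  (fun s => admissible s && (turn s == L))) /=; last first.
  move=> s sA; have [_ _ /ltnW jL _] := admissible_turnP s sA.
  by have [-> ->] := with_turnP s L sA jL (leqnn L); rewrite eqxx.
apply: eq_bigr => u /andP[uA /eqP uL].
have [_ _ jL tpu] := admissible_turnP u uA.
rewrite -sum_path_weight // mulr_sumr.
rewrite (reindex_onto (fun k : 'I_L.+1 => with_turn u (entry u) k)
  (fun s => inord (turn s))) /=; last first.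
  move=> s /andP[sA /eqP <-]; have [_ kL sL tp] := admissible_turnP s sA.
  have [_ _ -> _] := with_turnP s L sA (ltnW sL) (leqnn L).
  by rewrite inordK // with_turnK with_turn_id.
rewrite (eq_bigl (fun k : 'I_L.+1 => (entry u <= k)%N)) => [|k].
  by apply: eq_bigr => k jk; apply: wt_with_turn => //; rewrite -ltnS.
have kL : (k <= L)%N by rewrite -ltnS.
(* If the state built from an arbitrary [k] is admissible, uniqueness of its path makes [k] its
   turning point, which is not left of the entry. *)
apply/idP/idP => [/andP[/andP[sA _] _]|jk'].
  have [jk' kL' jL' tp'] := admissible_turnP _ sA.
  have [|e1 e2] := turn_path_inj _ _ _ _ _ jL kL jL' kL' _ tp'; last by lia.
  by apply: with_turn_path; case: tpu.
have [-> -> -> _] := with_turnP u k uA jk' kL.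
rewrite with_turnK inord_val eqxx andbT /=.
by rewrite -[in X in _ == X](with_turn_id u uA) uL.
Qed.

End Weight.
End LastPair.

(** * The functional equation of the partition function *)

Theorem theorem6 (R : realType) (n r : nat) (v : R[i]) (g : int -> R[i])
    (lambda : r.-tuple nat) (z : 'I_r -> R[i]) (c : 'I_r -> int)
    (last : 'I_r) (e C : int)
    (n_odd : odd n)
    (r_ge1 : (1 <= r)%N)
    (last_eq : last.+1 = r)
    (v_neq0 : v != 0)
    (g_periodic : forall a : int, g (a + n%:Z) = g a)
    (g_0 : g 0 = - v)
    (g_mul : forall a : int, ~~ (n%:Z %| a)%Z -> g a * g (n%:Z - a) = v)
    (lambda_partition : sorted geq lambda)
    (z_neq0 : forall i, z i != 0)
    (c_range : forall k, 0 <= c k < n%:Z)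
    (e_range : 0 <= e < n%:Z)
    (e_eq : (e = c last - (head 0%N lambda + r + 1)%:Z %[mod n%:Z])%Z)
    (C_range : 0 <= C < n%:Z)
    (C_eq : (C = c last - 2 * e %[mod n%:Z])%Z) :
  (1 - v) * z last ^ (n%:Z - 2 * e) * partition_function n g v lambda z c
  + g (2 * e) * (z last ^- n - z last ^+ n)
    * partition_function n g v lambda z [eta c with last |-> C]
  = (z last ^- n - v * z last ^+ n)
    * partition_function n g v lambda [eta z with last |-> (z last)^-1] c.
Proof.
case: e e_range e_eq C_eq => // e /andP[_ en] e_eq C_eq.
have zl0 := z_neq0 last.
have zl0' : [eta z with last |-> (z last)^-1] last != 0.
  by rewrite /= eqxx invr_neq0.
(* The index set depends neither on [z] nor on [c], so the three expansions are compared term by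
   term. *)
rewrite !(partition_functionE _ _ _ last_eq) // !mulr_sumr -big_split.
apply: eq_bigr => s /andP[sA _].
have [_ _ jL _] := admissible_turnP _ _ _ last_eq s sA.
have wC : off_last_weight r lambda last _ n g v z [eta c with last |-> C] s =
    off_last_weight r lambda last _ n g v z c s.
  by apply: off_last_weight_eq => // i /negbTE /= ->.
have wz : off_last_weight r lambda last _ n g v
      [eta z with last |-> (z last)^-1] c s =
    off_last_weight r lambda last _ n g v z c s.
  by apply: off_last_weight_eq => // i /negbTE /= ->.
rewrite wC wz /= eqxx.
have NE : (head 0%N lambda + r + 1)%N = (ncols lambda).+1 by rewrite addn1.
rewrite NE in e_eq.
have eE : (c last - (ncols lambda).+1%:Z = e%:Z %[mod n%:Z])%Z by [].
(* Replacing [c last] by [C] reflects the residue [e] to [- e], exchanging the roles of the two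
   summands of [last_sum]. *)
have CE : (C - (ncols lambda).+1%:Z = - e%:Z %[mod n%:Z])%Z.
  move/eqP: C_eq; move/eqP: eE; rewrite !eqz_mod_dvd => eE CE.
  apply/eqP; rewrite eqz_mod_dvd.
  have -> : C - (ncols lambda).+1%:Z - - e%:Z = (C - (c last - 2 * e%:Z))
    + (c last - (ncols lambda).+1%:Z - e%:Z) by ring.
  exact: rpredD.
rewrite !(last_sum_mod _ _ _ _ _ _ _ _ eE) (last_sum_mod _ _ _ _ _ _ _ _ CE).
have -> : z last ^ (n%:Z - 2 * e%:Z) = z last ^+ n * z last ^- (2 * e).
  by rewrite expfzDr // exprnN.
have m0 : (0 < ncols lambda - entry r lambda last s)%N by rewrite subn_gt0.
have := last_sum_identity _ n g v n_odd g_periodic g_0 g_mul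
  (z last) _ e zl0 m0 en.
set S1 := last_sum _ _ _ _ _ _ _; set S2 := last_sum _ _ _ _ _ _ (- _).
set S3 := last_sum _ _ _ _ _^-1 _ _ => id.
by rewrite mulrCA [X in _ + X]mulrCA -mulrDr id mulrCA.
Qed.
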